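(* Let $Q$ be a compact Hausdorff topological quandle. The following are equivalent: (1) $Q$ is profinite. (2) $Q$ is topologically residually finite. (3) $Q$ is a closed subquandle of a direct product of finite quandles.
   Context: A quandle is a non-empty set $Q$ with a binary operation $*$ such that $x*x=x$; for all $x,y$ there is a unique $z$ with $x=z*y$ (write $z=x*^{-1}y$); and $(x*y)*z=(x*z)*(y*z)$. A topological quandle is a quandle with a topology such that $*:Q\times Q\to Q$ is continuous and each right multiplication $R_q:p\mapsto p*q$ is a homeomorphism of $Q$. A subspace $P$ of a topological quandle is a subquandle if $a*b\in P$ for all $a,b\in P$ and, for each $b\in P$, $y\mapsto y*b$ is a homeomorphism of $P$ onto itself. Finite quandles carry the discrete topology and products the product topology. A directed set is a set with a reflexive transitive relation in which any two elements have an upper bound. A projective system of finite quandles over a directed set $I$ consists of finite quandles $Q_i$ and homomorphisms $\varphi_{ij}:Q_j\to Q_i$ for $i\le j$ with $\varphi_{ii}=\mathrm{id}$ and $\varphi_{ij}\circ\varphi_{jk}=\varphi_{ik}$; its projective limit is $\{(q_i)\in\prod_i Q_i:\varphi_{ij}(q_j)=q_i \text{ for } i\le j\}$ with the subspace topology. $Q$ is profinite if it is the projective limit of some projective system of finite quandles. A Hausdorff topological quandle $Q$ is topologically residually finite if for any distinct $a,b\in Q$ there exist a finite quandle $F$ with the discrete topology and a continuous homomorphism $f:Q\to F$ with $f(a)\ne f(b)$. In (1) and (3), ''is'' is understood up to isomorphism of topological quandles (quandle isomorphisms that are homeomorphisms). *)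

(* Defs.v *)
From HB Require Import structures.
From mathcomp Require Import all_boot.
From mathcomp Require Import all_classical.
From mathcomp Require Import topology.

Set Implicit Arguments.
Unset Strict Implicit.
Unset Printing Implicit Defensive.

Local Open Scope classical_set_scope.

HB.mixin Record isQuandle (Q : Type) := {
  qop : Q -> Q -> Q;
  quandle_nonempty : inhabited Q;
  qopxx : forall x : Q, qop x x = x;
  qop_rdiv : forall x y : Q, exists! z : Q, x = qop z y;
  qop_distr : forall x y z : Q, qop (qop x y) z = qop (qop x z) (qop y z)
}.

#[short(type="quandleType")]
HB.structure Definition Quandle := {Q of isQuandle Q}.

(* These two joins make the finite and the topological quandles share their
   underlying eqType and choiceType. *)
#[short(type="eqQuandleType")]
HB.structure Definition EqQuandle := {Q of Equality Q & isQuandle Q}.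

#[short(type="choiceQuandleType")]
HB.structure Definition ChoiceQuandle := {Q of Choice Q & isQuandle Q}.

#[short(type="finQuandleType")]
HB.structure Definition FinQuandle := {Q of Finite Q & isQuandle Q}.

Declare Scope quandle_scope.
Delimit Scope quandle_scope with quandle.
Notation "x ◃ y" := (qop x y)
  (at level 40, left associativity) : quandle_scope.
Local Open Scope quandle_scope.

Definition quandle_hom (Q R : quandleType) (f : Q -> R) : Prop :=
  forall x y : Q, f (x ◃ y) = f x ◃ f y.

Definition homeomorphism (S T : topologicalType) (f : S -> T) : Prop :=
  exists g : T -> S,
    [/\ cancel f g, cancel g f, continuous f & continuous g].

HB.mixin Record isTopQuandle Q & Topological Q & Quandle Q := {
  qop_continuous : continuous (fun p : Q * Q => p.1 ◃ p.2);
  qop_homeo : forall q : Q, homeomorphism (fun p : Q => p ◃ q)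
}.

#[short(type="topQuandleType")]
HB.structure Definition TopQuandle :=
  {Q of Topological Q & Quandle Q & isTopQuandle Q}.

Section DiscreteQuandle.
Variable F : finQuandleType.

HB.instance Definition _ := isQuandle.Build (discrete_topology F)
  (@quandle_nonempty F) (@qopxx F) (@qop_rdiv F) (@qop_distr F).

Lemma discrete_dom_continuous (X : discreteTopologicalType)
  (T : topologicalType) (f : X -> T) : continuous f.
Proof. by apply/continuousP => A _; exact: discrete_open. Qed.

Let D := discrete_topology F.

Lemma discrete_qop_continuous : continuous (fun p : D * D => p.1 ◃ p.2).
Proof.
case=> x y A Axy; exists ([set x], [set y]).
  by split; exact: discrete_set1.
by case=> a b [/= -> ->]; exact: (nbhs_singleton Axy).
Qed.

Lemma discrete_qop_homeo (q : D) : homeomorphism (fun p : D => p ◃ q).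
Proof.
have [g gP] := choice (fun x : D => qop_rdiv x q).
exists g; split; try exact: discrete_dom_continuous.
- by move=> x; case: (gP (x ◃ q)) => _; apply.
- by move=> x; case: (gP x).
Qed.

HB.instance Definition _ := isTopQuandle.Build (discrete_topology F)
  discrete_qop_continuous discrete_qop_homeo.

End DiscreteQuandle.

Section ProductQuandle.
Variables (I : Type) (T : I -> topQuandleType).
Let P := prod_topology T.

Definition prod_qop (x y : P) : P := fun i => x i ◃ y i.

Lemma prod_quandle_nonempty : inhabited P.
Proof.
have xP i : {x : T i | True}.
  by apply: cid; case: (@quandle_nonempty (T i)) => x; exists x.
by split=> i; exact: sval (xP i).
Qed.

Lemma prod_qopxx (x : P) : prod_qop x x = x.
Proof. by apply: functional_extensionality_dep => i; exact: qopxx. Qed.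

Lemma prod_qop_rdiv (x y : P) : exists! z : P, x = prod_qop z y.
Proof.
have zP i := cid (qop_rdiv (x i) (y i)).
exists (fun i => sval (zP i)); split.
  by apply: functional_extensionality_dep => i; case: (svalP (zP i)).
move=> z' xz'; apply: functional_extensionality_dep => i.
by case: (svalP (zP i)) => _; apply; rewrite xz'.
Qed.

Lemma prod_qop_distr (x y z : P) :
  prod_qop (prod_qop x y) z = prod_qop (prod_qop x z) (prod_qop y z).
Proof. by apply: functional_extensionality_dep => i; exact: qop_distr. Qed.

HB.instance Definition _ := isQuandle.Build (prod_topology T)
  prod_quandle_nonempty prod_qopxx prod_qop_rdiv prod_qop_distr.

Lemma prod_coord_continuous (i : I) : continuous (fun x : P => x i).
Proof. exact: (@proj_continuous {classic I} T i). Qed.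

Lemma prod_continuous (S : topologicalType) (f : S -> P) :
  (forall i, continuous (fun x => f x i)) -> continuous f.
Proof.
move=> cf x; apply/cvg_sup => i A [_ [[B oB <-] Bx] BA].
apply: filterS BA _; apply: (cf i x).
exact: open_nbhs_nbhs.
Qed.

Lemma prod_qop_continuous : continuous (fun p : P * P => p.1 ◃ p.2).
Proof.
apply: prod_continuous => i p.
apply: (@continuous2_cvg _ _ _ _ (nbhs p) _ (fun p : P * P => p.1 i)
  (fun p : P * P => p.2 i) (@qop (T i))).
- exact: (@qop_continuous (T i) (p.1 i, p.2 i)).
- exact: (continuous_comp cvg_fst (@prod_coord_continuous i _)).
- exact: (continuous_comp cvg_snd (@prod_coord_continuous i _)).
Qed.

Lemma prod_qop_homeo (q : P) : homeomorphism (fun p : P => p ◃ q).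
Proof.
have hP i := cid (@qop_homeo (T i) (q i)).
pose g i := sval (hP i).
have gP i : [/\ cancel (@qop (T i) ^~ (q i)) (g i),
    cancel (g i) (@qop (T i) ^~ (q i)),
    continuous (@qop (T i) ^~ (q i)) & continuous (g i)] := svalP (hP i).
exists (fun p i => g i (p i)); split.
- move=> x; apply: functional_extensionality_dep => i.
  by have [fK _ _ _] := gP i; exact: fK.
- move=> x; apply: functional_extensionality_dep => i.
  by have [_ gK _ _] := gP i; exact: gK.
- apply: prod_continuous => i x; have [_ _ cf _] := gP i.
  exact: (continuous_comp (@prod_coord_continuous i _) (cf _)).
- apply: prod_continuous => i x; have [_ _ _ cg] := gP i.
  exact: (continuous_comp (@prod_coord_continuous i _) (cg _)).
Qed.

HB.instance Definition _ := isTopQuandle.Build (prod_topology T)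
  prod_qop_continuous prod_qop_homeo.

End ProductQuandle.

Definition finite_product (I : Type) (F : I -> finQuandleType)
  : topQuandleType := prod_topology (fun i => discrete_topology (F i)).

(* A set [A] used as a type is [set_type A], with the subspace topology. *)
Definition subquandle (P : topQuandleType) (A : set P) : Prop :=
  (forall a b : P, A a -> A b -> A (a ◃ b)) /\
  (forall b : P, A b -> exists r : A -> A,
     homeomorphism r /\ forall y : A, set_val (r y) = set_val y ◃ b).

(* [Q] is isomorphic, as a topological quandle, to the subspace [A] of [P] with
   the operation inherited from [P]. The second clause makes [A] closed under
   this operation. *)
Definition isomorphic_to_subset (Q P : topQuandleType) (A : set P) : Prop :=
  exists f : Q -> A, homeomorphism f /\
    forall x y : Q, set_val (f (x ◃ y)) = set_val (f x) ◃ set_val (f y).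

Record projective_system := ProjectiveSystem {
  ps_index : Type;
  ps_le : ps_index -> ps_index -> Prop;
  ps_le_refl : forall i, ps_le i i;
  ps_le_trans : forall i j k, ps_le i j -> ps_le j k -> ps_le i k;
  ps_directed : forall i j, exists k, ps_le i k /\ ps_le j k;
  ps_obj : ps_index -> finQuandleType;
  ps_map : forall i j, ps_le i j -> ps_obj j -> ps_obj i;
  ps_map_hom : forall i j (ij : ps_le i j), quandle_hom (ps_map ij);
  ps_map_id : forall i (ii : ps_le i i), ps_map ii =1 id;
  ps_map_comp : forall i j k (ij : ps_le i j) (jk : ps_le j k) (ik : ps_le i k),
    ps_map ij \o ps_map jk =1 ps_map ik
}.

Definition projective_limit (S : projective_system)
  : set (finite_product (@ps_obj S)) :=
  [set q | forall i j (ij : ps_le i j), ps_map ij (q j) = q i].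
Arguments projective_limit : clear implicits.

Definition profinite (Q : topQuandleType) : Prop :=
  exists S : projective_system, isomorphic_to_subset Q (projective_limit S).

Definition top_residually_finite (Q : topQuandleType) : Prop :=
  hausdorff_space Q /\
  forall a b : Q, a <> b ->
    exists (F : finQuandleType) (f : Q -> discrete_topology F),
      [/\ continuous f, quandle_hom f & f a <> f b].

Definition closed_subquandle_of_finite_product (Q : topQuandleType) : Prop :=
  exists (I : Type) (F : I -> finQuandleType) (A : set (finite_product F)),
    [/\ closed A, subquandle A & isomorphic_to_subset Q A].

(* Main.v *)
Require Import Defs.
From mathcomp Require Import all_boot all_classical topology.
From HB Require Import structures.

Set Implicit Arguments.
Unset Strict Implicit.
Unset Printing Implicit Defensive.

Local Open Scope classical_set_scope.
Local Open Scope quandle_scope.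

(** The hub is residual finiteness. A subspace of a product of finite quandles,
    in particular a projective limit, is separated by its coordinates, which are
    continuous homomorphisms to finite quandles
    ([subset_of_finite_product_residually_finite]).

    Conversely, a family of continuous homomorphisms from Q to finite quandles
    that separates points gives a continuous injective homomorphism from Q to
    their product. Since Q is compact and the product is Hausdorff, this map is
    closed, hence an isomorphism onto a closed image ([compact_embedding]). One
    homomorphism for each pair of distinct points yields a closed subquandle.

    For profiniteness the family must be directed and the image must be the
    whole limit, so all finite quotients of Q are used. They are directed
    because two quotients are dominated by the image of Q in their product
    ([common_refinement]). A compatible family of points in the quotients
    determines a downward directed family of nonempty closed fibers in Q; by
    compactness they have a common point, which is sent to that family
    ([residually_finite_profinite]). *)

(** * Homomorphisms and finite quotients *)

Lemma rdiv_inj (Q : quandleType) (y : Q) : injective (fun x => x ◃ y).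
Proof.
move=> x x' /= e; have [z [_ zP]] := qop_rdiv (x ◃ y) y.
by rewrite -(zP x) // -(zP x').
Qed.

(** The reverse implication, cancellation, is what makes the right
    multiplications of the quotient by this kernel injective. *)
Lemma hom_kernel_congruence (Q R : quandleType) (f : Q -> R) :
  quandle_hom f -> forall x x' y y', f y = f y' ->
  f x = f x' <-> f (x ◃ y) = f (x' ◃ y').
Proof.
by move=> fM x x' y y' eyy'; rewrite !fM eyy'; split=> [->//|/rdiv_inj].
Qed.

(** The quotient of [Q] by the kernel of [f], realized as the image of [f] with
    the operation carried over from [Q]. As [T] has no operation, this covers at
    once images of homomorphisms and images in products of quandles. *)
Lemma finite_quotient (Q : quandleType) (T : finType) (f : Q -> T) :
  (forall x x' y y', f y = f y' -> f x = f x' <-> f (x ◃ y) = f (x' ◃ y')) ->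
  exists (F : finQuandleType) (g : Q -> F),
    [/\ quandle_hom g, forall u, exists x, g x = u &
        forall x y, g x = g y <-> f x = f y].
Proof.
move=> fcong.
pose S := {t : T | `[< exists x, f x = t >]}.
pose g (x : Q) : S := exist _ (f x) (asboolT (ex_intro _ x erefl)).
have gE x y : g x = g y <-> f x = f y.
  by split=> [/(congr1 val)|e] //; exact: val_inj.
have gsurj (u : S) : exists x, g x = u.
  by case: u => t tP; have [x xt] := asboolW tP; exists x; exact: val_inj.
have [s sK] := choice gsurj.
pose op u v := g (s u ◃ s v).
have gM x y : g (x ◃ y) = op (g x) (g y).
  have skE z : f z = f (s (g z)) by apply/gE; rewrite sK.
  by apply/gE; apply: (iffLR (fcong _ _ _ _ (skE y))); exact: skE.
have op_inh : inhabited S.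
  by have [x] := @quandle_nonempty Q; exists; exact: g x.
have opxx u : op u u = u by rewrite /op qopxx.
have op_rdiv u v : exists! w, u = op w v.
  have [[x <-] [y <-]] := (gsurj u, gsurj v).
  have [z [xE _]] := qop_rdiv x y; exists (g z); split; first by rewrite -gM -xE.
  move=> w; have [z' <-] := gsurj w; rewrite {1}xE -gM => /gE e.
  by apply/gE; apply: (iffRL (fcong _ _ y y erefl)).
have op_distr u v w : op (op u v) w = op (op u w) (op v w).
  have [[[x <-] [y <-]] [z <-]] := (gsurj u, gsurj v, gsurj w).
  by rewrite -!gM qop_distr.
pose F : finQuandleType := HB.pack_for finQuandleType S
  (isQuandle.Build S op_inh opxx op_rdiv op_distr).
by exists F, g; split.
Qed.

(** Continuity is seen to depend on the kernel of [f] only, so that it passes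
    to any other map with the same or a larger kernel. *)
Lemma continuous_discreteP (T : topologicalType) (X : choiceType)
    (f : T -> discrete_topology X) :
  continuous f <-> forall x, \forall y \near x, f y = f x.
Proof.
split=> [cf x|fnear x A Afx].
  by apply: (cf x [set f x]); exact: discrete_set1.
apply: filterS (fnear x) => y; rewrite /= => ->.
exact: nbhs_singleton Afx.
Qed.

(** The image of [Q] in [F1 * F2]. With [f1 = f2] this replaces a homomorphism
    by a surjective one with the same kernel. *)
Lemma common_refinement (Q : topQuandleType) (F1 F2 : finQuandleType)
    (f1 : Q -> discrete_topology F1) (f2 : Q -> discrete_topology F2) :
  continuous f1 -> quandle_hom f1 -> continuous f2 -> quandle_hom f2 ->
  exists (F : finQuandleType) (g : Q -> discrete_topology F),
    [/\ continuous g, quandle_hom g, forall u, exists x, g x = u &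
        forall x y, g x = g y <-> f1 x = f1 y /\ f2 x = f2 y].
Proof.
move=> /continuous_discreteP c1 h1 /continuous_discreteP c2 h2.
pose f x : (F1 * F2)%type := (f1 x, f2 x).
have fE x y : f x = f y <-> f1 x = f1 y /\ f2 x = f2 y.
  by split=> [[]//|[e1 e2]]; rewrite /f e1 e2.
have [x x' y y'|F [g [gM gsurj gE]]] := @finite_quotient Q _ f.
  move=> /fE [e1 e2]; rewrite !fE.
  have k1 := hom_kernel_congruence h1 x x' e1.
  have k2 := hom_kernel_congruence h2 x x' e2.
  by split=> -[/k1 ? /k2 ?].
exists F, g; split=> //; last by move=> x y; rewrite -fE.
apply/continuous_discreteP => x; near=> y.
apply/gE/fE; split; first by near: y; exact: c1.
by near: y; exact: c2.
Unshelve. all: by end_near. Qed.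

(** * Compact quandles embedded in products *)

(** A continuous bijection from a compact space to a Hausdorff one is closed,
    so its inverse is continuous. *)
Lemma compact_embedding (Q P : topQuandleType) (A : set P) (f : Q -> P) :
  compact [set: Q] -> hausdorff_space P ->
  continuous f -> injective f -> quandle_hom f -> range f = A ->
  isomorphic_to_subset Q A.
Proof.
move=> cQ hP cf finj fM fA.
have fAx x : A (f x) by rewrite -fA; exists x.
pose h x : A := SigSub (mem_set (fAx x)).
have hsurj (u : A) : exists x, h x = u.
  have : A (set_val u) by exact: set_valP.
  by rewrite -{1}fA => -[x _ xu]; exists x; apply: val_inj.
have [g gK] := choice hsurj.
have hK x : g (h x) = x by apply: finj; rewrite -[LHS]/(set_val (h _)) gK.
exists h; split; last by move=> x y; exact: fM.
exists g; split=> //.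
  by apply: continuous_comp_initial; exact: cf.
apply/continuous_closedP => C cC.
have -> : g @^-1` C = set_val @^-1` (f @` C).
  apply/seteqP; split=> u /=.
    move=> Cgu; exists (g u) => //.
    by rewrite -[LHS]/(set_val (h _)) gK.
  by case=> x Cx xu; rewrite (_ : u = h x) ?hK //; apply: val_inj.
apply: preimage_closed => [u _|]; first exact: initial_continuous.
apply: compact_closed => //; apply: continuous_compact.
  exact: continuous_subspaceT.
exact: (subclosed_compact cC cQ).
Qed.

Lemma finite_product_hausdorff (I : Type) (F : I -> finQuandleType) :
  hausdorff_space (finite_product F).
Proof.
by apply: (@hausdorff_product {classic I}) => i; exact: discrete_hausdorff.
Qed.

(** Points of a product differ in some coordinate. *)
Lemma subset_of_finite_product_residually_finite (Q : topQuandleType)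
    (I : Type) (F : I -> finQuandleType) (A : set (finite_product F)) :
  hausdorff_space Q -> isomorphic_to_subset Q A -> top_residually_finite Q.
Proof.
move=> hQ [f [[g [fK _ cf _]] fM]]; split=> // a b ab.
have [i fab] : exists i, set_val (f a) i <> set_val (f b) i.
  apply: contrapT => /forallNP fab; apply: ab; apply: (can_inj fK).
  apply: val_inj; apply: functional_extensionality_dep => i.
  exact: contrapT (fab i).
exists (F i), (fun x => set_val (f x) i); split=> //.
  move=> x; apply: (@continuous_comp _ _ _ (fun x => set_val (f x))
      (fun p : finite_product F => p i)).
    apply: (@continuous_comp _ _ _ f); first exact: cf.
    exact: initial_continuous.
  exact: prod_coord_continuous.
by move=> x y; rewrite fM.
Qed.

(** Both clauses of [subquandle] are transported along the isomorphism: the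
    right multiplication by [b] on [A] is conjugate to the one on [Q]. *)
Lemma subset_subquandle (Q P : topQuandleType) (A : set P) :
  isomorphic_to_subset Q A -> subquandle A.
Proof.
move=> [f [[g [fK gK cf cg]] fM]]; split=> [a b Aa Ab|b Ab].
  pose u : A := SigSub (mem_set Aa); pose v : A := SigSub (mem_set Ab).
  rewrite -[a]/(set_val u) -[b]/(set_val v) -(gK u) -(gK v) -fM.
  exact: set_valP.
pose v : A := SigSub (mem_set Ab).
have [h [hK Kh ch c'h]] := qop_homeo (g v).
exists (fun u => f (g u ◃ g v)); split; last by move=> u; rewrite fM !gK.
exists (fun u => f (h (g u))); split.
- by move=> u; rewrite fK hK gK.
- by move=> u; rewrite fK Kh gK.
- move=> u; apply: (@continuous_comp _ _ _ (fun u => g u ◃ g v) f);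
    last exact: cf.
  by apply: (@continuous_comp _ _ _ g (fun x => x ◃ g v));
    [exact: cg|exact: ch].
- move=> u; apply: (@continuous_comp _ _ _ (fun u => h (g u)) f); last exact: cf.
  by apply: (@continuous_comp _ _ _ g h); [exact: cg|exact: c'h].
Qed.

Lemma residually_finite_closed_subquandle (Q : topQuandleType) :
  compact [set: Q] -> top_residually_finite Q ->
  closed_subquandle_of_finite_product Q.
Proof.
move=> cQ [_ sep].
pose I := {ab : Q * Q | ab.1 <> ab.2}.
have FP (i : I) := cid (sep _ _ (svalP i)).
pose F (i : I) : finQuandleType := sval (FP i).
have fP (i : I) := cid (svalP (FP i)).
pose f (x : Q) : finite_product F := fun i => sval (fP i) x.
have cf : continuous f.
  by apply: prod_continuous => i; have [] := svalP (fP i).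
have finj : injective f.
  move=> a b fab; apply: contrapT => ab.
  have [_ _] := svalP (fP (exist _ (a, b) ab)); apply.
  exact: (congr1 (fun p => p (exist _ (a, b) ab)) fab).
have fM : quandle_hom f.
  move=> x y; apply: functional_extensionality_dep => i.
  by have [_ fM _] := svalP (fP i); exact: fM.
have iso := compact_embedding cQ (@finite_product_hausdorff I F) cf finj fM
  erefl.
exists I, F, (range f); split=> //; last exact: subset_subquandle iso.
apply: compact_closed; first exact: finite_product_hausdorff.
by apply: continuous_compact => //; exact: continuous_subspaceT.
Qed.

(** * The projective system of finite quotients *)

Section QuotientSystem.
Variable Q : topQuandleType.

(** Finite quotients are indexed by their kernels. This keeps the index type
    small, independent of the universe of finite quandles, and makes
    domination of quotients reverse inclusion of kernels. *)
Definition is_quotient_kernel (R : Q -> Q -> Prop) : Prop :=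
  exists (F : finQuandleType) (f : Q -> discrete_topology F),
    [/\ continuous f, quandle_hom f, forall u, exists x, f x = u &
        forall x y, f x = f y <-> R x y].

Definition quotient_index := {R : Q -> Q -> Prop | is_quotient_kernel R}.

(** The trivial quotient shows it: a filter base must be nonempty, even when
    [Q] is a point and no quotient is needed to separate its points. *)
Lemma quotient_index_inhabited : inhabited quotient_index.
Proof.
have [|F [g [gM gsurj gE]]] := @finite_quotient Q unit (fun=> tt) => //.
have gP : is_quotient_kernel (fun x y => g x = g y).
  exists F, g; split=> //; apply/continuous_discreteP => x.
  by near=> y; apply/gE.
by exists; exact: exist _ _ gP.
Unshelve. all: by end_near. Qed.

Definition quotient_obj (i : quotient_index) : finQuandleType :=
  sval (cid (svalP i)).

Definition quotient_proj (i : quotient_index) :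
  Q -> discrete_topology (quotient_obj i) := sval (cid (svalP (cid (svalP i)))).

Lemma quotient_projP (i : quotient_index) :
  [/\ continuous (quotient_proj i), quandle_hom (quotient_proj i),
      forall u, exists x, quotient_proj i x = u &
      forall x y, quotient_proj i x = quotient_proj i y <-> sval i x y].
Proof. exact: svalP (cid (svalP (cid (svalP i)))). Qed.

Definition quotient_le (i j : quotient_index) : Prop :=
  forall x y, sval j x y -> sval i x y.

Definition quotient_lift (i : quotient_index) (u : quotient_obj i) : Q :=
  let: And4 _ _ s _ := quotient_projP i in sval (cid (s u)).

Lemma quotient_liftK i : cancel (@quotient_lift i) (quotient_proj i).
Proof.
by move=> u; rewrite /quotient_lift; case: quotient_projP => _ _ s _; case: cid.
Qed.

(** The choice of the lift does not matter, by [quotient_mapE]. *)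
Definition quotient_map i j (ij : quotient_le i j) (u : quotient_obj j)
  : quotient_obj i := quotient_proj i (quotient_lift u).

(** As the projections are surjective, this equation determines the transition
    maps; all their properties follow from it. *)
Lemma quotient_mapE i j (ij : quotient_le i j) x :
  quotient_map ij (quotient_proj j x) = quotient_proj i x.
Proof.
have [_ _ _ iE] := quotient_projP i; have [_ _ _ jE] := quotient_projP j.
by apply/iE/ij/jE; rewrite quotient_liftK.
Qed.

Lemma quotient_le_directed i j :
  exists k, quotient_le i k /\ quotient_le j k.
Proof.
have [ci hi _ iE] := quotient_projP i; have [cj hj _ jE] := quotient_projP j.
have [F [g [cg hg gsurj gE]]] := common_refinement ci hi cj hj.
have kP : is_quotient_kernel (fun x y => g x = g y) by exists F, g; split.
by exists (exist _ _ kP); split=> x y /= /gE [/iE ? /jE ?].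
Qed.

Lemma quotient_map_hom i j (ij : quotient_le i j) :
  quandle_hom (quotient_map ij).
Proof.
have [_ hi _ _] := quotient_projP i; have [_ hj _ _] := quotient_projP j.
move=> u v; rewrite -[u]quotient_liftK -[v]quotient_liftK.
by rewrite -[_ ◃ _ in LHS]hj !quotient_mapE; exact: hi.
Qed.

Lemma quotient_map_id i (ii : quotient_le i i) : quotient_map ii =1 id.
Proof. exact: quotient_liftK. Qed.

Lemma quotient_map_comp i j k (ij : quotient_le i j) (jk : quotient_le j k)
    (ik : quotient_le i k) :
  quotient_map ij \o quotient_map jk =1 quotient_map ik.
Proof. by move=> u; exact: quotient_mapE. Qed.

Definition quotient_system : projective_system :=
  @ProjectiveSystem quotient_index quotient_le
    (fun i x y ixy => ixy) (fun i j k ij jk x y kxy => ij x y (jk x y kxy))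
    quotient_le_directed quotient_obj quotient_map
    quotient_map_hom quotient_map_id quotient_map_comp.

(** The separating quotients make the map to the limit injective. It is
    surjective because the fibers over a point of the limit are nonempty and
    closed, and directedness makes them a filter base. *)
Lemma residually_finite_profinite :
  compact [set: Q] -> top_residually_finite Q -> profinite Q.
Proof.
move=> cQ [_ sep]; exists quotient_system.
pose f (x : Q) : finite_product (@ps_obj quotient_system) :=
  fun i => quotient_proj i x.
apply: (compact_embedding cQ (f := f)).
- exact: finite_product_hausdorff.
- by apply: prod_continuous => i; have [] := quotient_projP i.
- move=> a b fab; apply: contrapT => ab.
  have [F [h [ch hM hab]]] := sep a b ab.
  have [G [g [cg gM gsurj gE]]] := common_refinement ch hM ch hM.
  have iP : is_quotient_kernel (fun x y => g x = g y) by exists G, g; split.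
  have [_ _ _ iE] := quotient_projP (exist _ _ iP).
  by have /iE/gE [] := congr1 (fun p => p (exist _ _ iP)) fab.
- move=> x y; apply: functional_extensionality_dep => i.
  by have [_ iM _ _] := quotient_projP i; exact: iM.
apply/seteqP; split=> [_ [x _ <-] i j ij|q qlim]; first exact: quotient_mapE.
pose fiber i := [set x | quotient_proj i x = q i].
pose Fq := filter_from [set: quotient_index] fiber.
have pF : ProperFilter Fq.
  apply: filter_from_proper.
    apply: filter_from_filter.
      by have [i] := quotient_index_inhabited; exists i.
    move=> i j _ _; have [k [ik jk]] := quotient_le_directed i j.
    exists k => // x xk; split.
      by rewrite /fiber /= -(quotient_mapE ik) xk; exact: (qlim i k ik).
    by rewrite /fiber /= -(quotient_mapE jk) xk; exact: (qlim j k jk).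
  move=> i _; have [_ _ s _] := quotient_projP i; exact: s.
(* Each fiber is closed, so it contains the cluster point [x]. *)
have [x [_ xFq]] := cQ Fq pF filterT.
exists x => //; apply: functional_extensionality_dep => i.
have [/continuous_discreteP ci _ _ _] := quotient_projP i.
have [|y [yi xy]] := xFq (fiber i) _ _ (ci x); first by exists i.
by rewrite /f -xy.
Qed.

End QuotientSystem.

Theorem theorem4p9 (Q : topQuandleType)
  (Q_compact : compact [set: Q]%classic) (Q_hausdorff : hausdorff_space Q) :
  (profinite Q <-> top_residually_finite Q) /\
  (top_residually_finite Q <-> closed_subquandle_of_finite_product Q).
Proof.
split; split.
- by case=> S; exact: subset_of_finite_product_residually_finite.
- exact: residually_finite_profinite.
- exact: residually_finite_closed_subquandle.
- by case=> I [F [A [_ _]]]; exact: subset_of_finite_product_residually_finite.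
Qed.
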